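(* Let $m,n$ be integers with $0<m\leq |n|$ and let $d=\gcd(m,n)$. Let $p$ denote the largest integer such that $2^p \mid 2\frac{m}{d}+2$. Then the $R_\infty$-nilpotency degree $r$ of $BS(m,n)$ satisfies: (i) if $n<0$ and $n\neq -m$, then $r=2$; (ii) if $n=-m$, then $r=\infty$; (iii) if $n=m$, then $r=\infty$; (iv) if $n-m=d$, then $r=\infty$; (v) if $n-m=2d$, then $2\leq r\leq p+2$; (vi) if $n-m\geq 3d$, then $r=2$.
   Context: For integers $m,n$, the Baumslag--Solitar group is $BS(m,n)=\langle a,b \mid a^{-1}b^m a=b^n\rangle$. For an endomorphism $\varphi$ of a group $G$, define the equivalence relation $x\sim y \Leftrightarrow \exists z\in G:\ x=z\,y\,\varphi(z)^{-1}$; the number of equivalence classes (possibly infinite) is denoted $R(\varphi)$. A group $G$ has the $R_\infty$-property if $R(\varphi)$ is infinite for every automorphism $\varphi$ of $G$. The lower central series of $G$ is $\gamma_1(G)=G$, $\gamma_{i+1}(G)=[G,\gamma_i(G)]$. The $R_\infty$-nilpotency degree of $G$ is the least positive integer $c$ such that $G/\gamma_{c+1}(G)$ has the $R_\infty$-property; if no such integer exists, the $R_\infty$-nilpotency degree is $\infty$. *)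

(* Defs.v *)
From HB Require Import structures.
From mathcomp Require Import all_boot all_order all_algebra.
From mathcomp Require Import boolp classical_sets cardinality.

Set Implicit Arguments.
Unset Strict Implicit.
Unset Printing Implicit Defensive.

Local Open Scope classical_set_scope.
Local Open Scope quotient_scope.
Local Open Scope group_scope.

Section Subgroups.
Context {G : groupType}.
Implicit Types (A B H N : set G).

Definition is_subgroup H : Prop :=
  H 1 /\ (forall x y, H x -> H y -> H (x * y^-1)).

Definition is_normal_subgroup N : Prop :=
  is_subgroup N /\ (forall x g, N x -> N (x ^ g)).

Definition generated_subgroup A : set G := smallest is_subgroup A.

Definition normal_closure A : set G := smallest is_normal_subgroup A.

Definition commutator_subgroup A B : set G :=
  generated_subgroup [set [~ x, y] | x in A & y in B].

(* [lower_central i] is gamma_i; the index starts at 1, index 0 being junk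
   (it also denotes the whole group). *)
Definition lower_central (i : nat) : set G :=
  iter i.-1 (commutator_subgroup [set: G]) [set: G].

Lemma subgroup1 H : is_subgroup H -> H 1.
Proof. by case. Qed.

Lemma subgroupV H x : is_subgroup H -> H x -> H x^-1.
Proof. by move=> [H1 HB] Hx; rewrite -[x^-1]mul1g; apply: HB. Qed.

Lemma subgroupM H x y : is_subgroup H -> H x -> H y -> H (x * y).
Proof.
move=> sH Hx Hy; rewrite -[y]invgK; apply: sH.2 => //.
exact: subgroupV.
Qed.

Lemma generated_subgroupP A : is_subgroup (generated_subgroup A).
Proof.
split=> [H [sH _]|x y Ax Ay H sAH]; first exact: sH.1.
by apply: sAH.1.2; [apply: Ax|apply: Ay].
Qed.

Lemma normal_closureP A : is_normal_subgroup (normal_closure A).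
Proof.
split; first split=> [N [nN _]|x y Ax Ay N sAN].
- exact: nN.1.1.
- by apply: sAN.1.1.2; [apply: Ax|apply: Ay].
- by move=> x g Ax N sAN; apply: sAN.1.2; apply: Ax.
Qed.

Lemma commutator_subgroup_normal N :
  is_normal_subgroup N -> is_normal_subgroup (commutator_subgroup [set: G] N).
Proof.
move=> nN; have sC := generated_subgroupP [set [~ x, y] | x in [set: G] & y in N].
split=> // x g Cx.
apply: (Cx [set z | commutator_subgroup [set: G] N (z ^ g)]); split=> /=.
  split=> [|y z /= Cy Cz]; first by rewrite /= conj1g; exact: sC.1.
  by rewrite conjMg conjVg; apply: sC.2.
move=> _ [y _ [z Nz <-]] /= H [sH]; apply.
by rewrite conjRg; exists (y ^ g) => //; exists (z ^ g) => //; apply: nN.2.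
Qed.

Lemma lower_central_normal i : is_normal_subgroup (lower_central i).
Proof.
rewrite /lower_central; elim: i.-1 => [//|j IHj].
exact: commutator_subgroup_normal.
Qed.

End Subgroups.

Record normalSubgroup (G : groupType) := NormalSubgroup {
  normalSubgroup_set : set G;
  normalSubgroupP : is_normal_subgroup normalSubgroup_set
}.

Definition lower_central_nsg (G : groupType) (i : nat) : normalSubgroup G :=
  NormalSubgroup (lower_central_normal i).

Definition normal_closure_nsg (G : groupType) (A : set G) : normalSubgroup G :=
  NormalSubgroup (normal_closureP A).

Section QuotientGroup.
Context {G : groupType} (N : normalSubgroup G).

Let sN : is_subgroup (normalSubgroup_set N) := (normalSubgroupP N).1.

Definition eq_mod_nsg (x y : G) : bool := `[< normalSubgroup_set N (x^-1 * y) >].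

Lemma eq_mod_nsg_refl : reflexive eq_mod_nsg.
Proof. by move=> x; apply/asboolP; rewrite mulVg; exact: subgroup1. Qed.

Lemma eq_mod_nsg_sym : symmetric eq_mod_nsg.
Proof.
by move=> x y; apply/asboolP/asboolP => /(subgroupV sN); rewrite invgM invgK.
Qed.

Lemma eq_mod_nsg_trans : transitive eq_mod_nsg.
Proof.
move=> y x z /asboolP Nxy /asboolP Nyz; apply/asboolP.
by rewrite -(mulVKg y z) mulgA; apply: subgroupM.
Qed.

Canonical eq_mod_nsg_equiv :=
  EquivRel eq_mod_nsg eq_mod_nsg_refl eq_mod_nsg_sym eq_mod_nsg_trans.

Definition quotient_group : Type := {eq_quot eq_mod_nsg}.

HB.instance Definition _ := Choice.on quotient_group.
HB.instance Definition _ := EqQuotient.on quotient_group.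

Definition quotient_mul (u v : quotient_group) : quotient_group :=
  \pi_quotient_group (repr u * repr v).

Definition quotient_inv (u : quotient_group) : quotient_group :=
  \pi_quotient_group (repr u)^-1.

Lemma quotient_piP (x y : G) :
  reflect (\pi_quotient_group x = \pi_quotient_group y)
    `[< normalSubgroup_set N (x^-1 * y) >].
Proof. exact: eqmodP. Qed.

Lemma quotient_piM (x y : G) :
  \pi_quotient_group (x * y)
  = quotient_mul (\pi_quotient_group x) (\pi_quotient_group y).
Proof.
rewrite /quotient_mul; apply/quotient_piP/asboolP.
have /esym/quotient_piP/asboolP := reprK (\pi_quotient_group x).
have /esym/quotient_piP/asboolP := reprK (\pi_quotient_group y).
move: (repr _) (repr _) => x' y' Ny Nx.
have -> : (x * y)^-1 * (x' * y') = (x^-1 * x') ^ y * (y^-1 * y').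
  by rewrite conjgE invgM !mulgA mulgK.
by apply: subgroupM => //; apply: (normalSubgroupP N).2.
Qed.

Lemma quotient_piV (x : G) :
  \pi_quotient_group x^-1 = quotient_inv (\pi_quotient_group x).
Proof.
rewrite /quotient_inv; apply/quotient_piP/asboolP.
have /quotient_piP/asboolP := reprK (\pi_quotient_group x).
move: (repr _) => x' Nx.
have -> : x^-1^-1 * x'^-1 = (x'^-1 * x) ^ x^-1.
  by rewrite conjgE !invgK !mulgA mulgK.
exact: (normalSubgroupP N).2.
Qed.

Lemma quotient_mulA : associative quotient_mul.
Proof.
move=> x y z; rewrite -[x]reprK -[y]reprK -[z]reprK.
rewrite -(quotient_piM (repr y) (repr z)) -(quotient_piM (repr x) (repr y)).
by rewrite -(quotient_piM (repr x)) -(quotient_piM _ (repr z)) mulgA.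
Qed.

Lemma quotient_mul1 :
  left_id (\pi_quotient_group 1) quotient_mul.
Proof. by move=> x; rewrite -[x]reprK -quotient_piM mul1g. Qed.

Lemma quotient_mulr1 :
  right_id (\pi_quotient_group 1) quotient_mul.
Proof. by move=> x; rewrite -[x]reprK -quotient_piM mulg1. Qed.

Lemma quotient_mulV :
  left_inverse (\pi_quotient_group 1) quotient_inv quotient_mul.
Proof. by move=> x; rewrite -[x]reprK -quotient_piV -quotient_piM mulVg. Qed.

Lemma quotient_mulrV :
  right_inverse (\pi_quotient_group 1) quotient_inv quotient_mul.
Proof. by move=> x; rewrite -[x]reprK -quotient_piV -quotient_piM mulgV. Qed.

HB.instance Definition _ := isGroup.Build quotient_group
  quotient_mulA quotient_mul1 quotient_mulr1 quotient_mulV quotient_mulrV.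

End QuotientGroup.

Section FreeGroup.
Context (X : choiceType).

(* The letter (x, false) stands for x, and (x, true) for its inverse. *)
Definition letter : Type := (X * bool)%type.

Inductive free_eq : seq letter -> seq letter -> Prop :=
| free_eq_refl w : free_eq w w
| free_eq_sym w1 w2 : free_eq w1 w2 -> free_eq w2 w1
| free_eq_trans w1 w2 w3 : free_eq w1 w2 -> free_eq w2 w3 -> free_eq w1 w3
| free_eq_cancel u v x e : free_eq (u ++ (x, e) :: (x, ~~ e) :: v) (u ++ v).

Definition free_eqb (w1 w2 : seq (X * bool)) : bool := `[< free_eq w1 w2 >].

Lemma free_eqb_refl : reflexive free_eqb.
Proof. by move=> w; apply/asboolP; exact: free_eq_refl. Qed.

Lemma free_eqb_sym : symmetric free_eqb.
Proof. by move=> v w; apply/asboolP/asboolP; exact: free_eq_sym. Qed.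

Lemma free_eqb_trans : transitive free_eqb.
Proof.
by move=> v u w /asboolP uv /asboolP vw; apply/asboolP; exact: free_eq_trans vw.
Qed.

Canonical free_eq_equiv :=
  EquivRel free_eqb free_eqb_refl free_eqb_sym free_eqb_trans.

Definition free_group : Type := {eq_quot free_eqb}.

HB.instance Definition _ := Choice.on free_group.
HB.instance Definition _ := EqQuotient.on free_group.

Definition word_inv (w : seq letter) : seq letter :=
  rev [seq (l.1, ~~ l.2) | l <- w].

Definition free_one : free_group := \pi_free_group [::].

Definition free_mul (u v : free_group) : free_group :=
  \pi_free_group (repr u ++ repr v).

Definition free_inv (u : free_group) : free_group :=
  \pi_free_group (word_inv (repr u)).

Definition free_gen (x : X) : free_group := \pi_free_group [:: (x, false)].

Lemma free_eq_cat w1 w2 u v :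
  free_eq w1 w2 -> free_eq (u ++ w1 ++ v) (u ++ w2 ++ v).
Proof.
elim=> {w1 w2} [w|w1 w2 _ IH|w1 w2 w3 _ IH12 _ IH23|u' v' x e].
- exact: free_eq_refl.
- exact: free_eq_sym.
- exact: free_eq_trans IH23.
- by rewrite -!catA /= !(catA u u'); apply: free_eq_cancel.
Qed.

Lemma word_inv_cat u v : word_inv (u ++ v) = word_inv v ++ word_inv u.
Proof. by rewrite /word_inv map_cat rev_cat. Qed.

Lemma free_eq_inv w1 w2 : free_eq w1 w2 -> free_eq (word_inv w1) (word_inv w2).
Proof.
elim=> {w1 w2} [w|w1 w2 _ IH|w1 w2 w3 _ IH12 _ IH23|u v x e].
- exact: free_eq_refl.
- exact: free_eq_sym.
- exact: free_eq_trans IH23.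
- rewrite -cat1s -(cat1s (x, ~~ e)) !word_inv_cat -!catA.
  by rewrite {2 3}/word_inv /rev /= negbK; exact: free_eq_cancel.
Qed.

Lemma word_invK : involutive word_inv.
Proof.
move=> w; rewrite /word_inv map_rev revK -map_comp map_id_in // => -[x e] _ /=.
by rewrite negbK.
Qed.

Lemma free_eq_mulV w : free_eq (w ++ word_inv w) [::].
Proof.
elim: w => [|[x e] w IHw]; first exact: free_eq_refl.
rewrite -cat1s word_inv_cat -catA (catA w).
apply: free_eq_trans (free_eq_cat _ _ IHw) _.
exact: (free_eq_cancel [::] [::]).
Qed.

Lemma free_piP (u v : seq (X * bool)) :
  reflect (\pi_free_group u = \pi_free_group v) `[< free_eq u v >].
Proof. exact: eqmodP. Qed.

Lemma free_piM (u v : seq (X * bool)) :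
  \pi_free_group (u ++ v) = free_mul (\pi_free_group u) (\pi_free_group v).
Proof.
rewrite /free_mul; apply/free_piP/asboolP.
have /esym/free_piP/asboolP := reprK (\pi_free_group u).
have /esym/free_piP/asboolP := reprK (\pi_free_group v).
move: (repr _) (repr _) => u' v' vv' uu'.
apply: (@free_eq_trans _ (u' ++ v)); first exact: (free_eq_cat [::] v uu').
by have := free_eq_cat u' [::] vv'; rewrite !cats0.
Qed.

Lemma free_piV (u : seq (X * bool)) :
  \pi_free_group (word_inv u) = free_inv (\pi_free_group u).
Proof.
apply/free_piP/asboolP/free_eq_inv.
by have /esym/free_piP/asboolP := reprK (\pi_free_group u).
Qed.

Lemma free_mulA : associative free_mul.
Proof.
move=> x y z; rewrite -[x]reprK -[y]reprK -[z]reprK.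
rewrite -(free_piM (repr y) (repr z)) -(free_piM (repr x) (repr y)).
by rewrite -(free_piM (repr x)) -(free_piM _ (repr z)) catA.
Qed.

Lemma free_mul1 : left_id free_one free_mul.
Proof. by move=> x; rewrite -[x]reprK -free_piM. Qed.

Lemma free_mulr1 : right_id free_one free_mul.
Proof. by move=> x; rewrite -[x]reprK -free_piM cats0. Qed.

Lemma free_mulrV : right_inverse free_one free_inv free_mul.
Proof.
move=> x; rewrite -[x]reprK -free_piV -free_piM.
exact/free_piP/asboolP/free_eq_mulV.
Qed.

Lemma free_mulV : left_inverse free_one free_inv free_mul.
Proof.
move=> x; rewrite -[x]reprK -free_piV -free_piM -{2}(word_invK (repr x)).
exact/free_piP/asboolP/free_eq_mulV.
Qed.

HB.instance Definition _ := isGroup.Build free_group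
  free_mulA free_mul1 free_mulr1 free_mulV free_mulrV.

End FreeGroup.

Definition expgz (G : groupType) (x : G) (k : int) : G :=
  match k with
  | Posz n => x ^+ n
  | Negz n => x ^- n.+1
  end.

Definition BS_relator (m n : int) : free_group bool :=
  let a := free_gen true in
  let b := free_gen false in
  a^-1 * expgz b m * a * (expgz b n)^-1.

Definition BS (m n : int) : groupType :=
  quotient_group (normal_closure_nsg [set BS_relator m n]).

Definition twisted_conj (G : groupType) (phi : G -> G) (x y : G) : Prop :=
  exists z, x = z * y * (phi z)^-1.

Definition Reidemeister_classes (G : groupType) (phi : G -> G) : set (set G) :=
  range (fun y => [set x | twisted_conj phi x y]).

Definition has_Rinfty (G : groupType) : Prop :=
  forall phi : {multiplicative G -> G},
    bijective phi -> infinite_set (Reidemeister_classes phi).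

Definition Rinfty_at (G : groupType) (c : nat) : Prop :=
  (0 < c)%N /\ has_Rinfty (quotient_group (lower_central_nsg G c.+1)).

Lemma Rinfty_at_asbool (G : groupType) :
  (exists c, Rinfty_at G c) -> exists c, `[< Rinfty_at G c >].
Proof. by case=> c Gc; exists c; apply/asboolP. Qed.

(* [None] encodes an infinite degree. *)
Definition Rinfty_nilpotency_degree (G : groupType) : option nat :=
  if pselect (exists c, Rinfty_at G c) is left ex
  then Some (ex_minn (Rinfty_at_asbool ex))
  else None.

(* Main.v *)
Require Import Defs.
From HB Require Import structures.
From mathcomp Require Import all_boot all_order all_algebra.
From mathcomp Require Import boolp classical_sets cardinality.
From mathcomp Require Import zify ring.
Import Order.TTheory GRing.Theory Num.Theory.

Set Implicit Arguments.
Unset Strict Implicit.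
Unset Printing Implicit Defensive.

(** Write m = d m', n = d n', k = n' - m', let G = BS(m, n) and let Q be the
    quotient of G of nilpotency class c.

    Suppose m and n differ. The exponent sum in a is, up to a factor, the only
    morphism from Q to Z, because b has finite order in the abelianization; so an
    automorphism of Q preserves it or changes its sign. If it is preserved, it
    separates infinitely many twisted conjugacy classes. Thus everything depends
    on whether Q has an automorphism that changes its sign, and whether such an
    automorphism has finitely many twisted classes.

    Finiteness: the derived subgroup of Q is finite ([finite_derived_subgroup]),
    because Q is finitely generated and some power of [a, b] lies in gamma_3, so
    that all factors of the lower central series from gamma_2 on are finite. It
    remains to count modulo gamma_2, where inverting a leaves two classes of
    powers of a, and the powers of b are finite in number
    ([finite_Reidemeister_inversion]).

    Existence: a |-> a^-1, b |-> b is an automorphism as soon as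
    a b^m a^-1 = b^n in Q ([not_Rinfty_neq]). This holds in the abelianization,
    so the degree is at least 2; it holds in G if n = - m; and if n - m = d, it
    holds because b^d = [b^m, a] dies in every nilpotent quotient
    ([BS_gcd_not_Rinfty]). For m = n one inverts both generators
    ([not_Rinfty_eq]).

    Obstruction: let A be the kernel of the exponent sum, made abelian; it is the
    module over Z[t, 1/t] generated by b, with m t b = n b and (t - 1)^c b = 0. An
    automorphism changing the sign exchanges t with its inverse on A, so the image
    g of b satisfies both m t g = n g and m g = n t g. In a suitable
    representation of A by rows modulo d k^c the factor d cancels, and since g
    again generates A one gets k^c | n'^2 - m'^2 ([inversion_dvd]). If |k| is at
    least 3, this fails already for c = 2 ([BS_Rinfty2]). If k = 2, then
    n'^2 - m'^2 = 2 (2 m' + 2), whose 2-adic valuation is p + 1, and it fails for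
    c = p + 2. *)

(** * Integer powers, morphisms and quotients of groups *)

Section IntegerPowers.
Local Open Scope group_scope.
Variable G : groupType.
Implicit Types (x y : G) (i j : int).

Lemma expgzS x i : expgz x (i + 1) = expgz x i * x.
Proof.
case: i => [n|[|n]].
- by rewrite -PoszD addn1 /= expgSr.
- by rewrite /= expg1 mulVg.
- have -> : (Negz n.+1 + 1 = Negz n)%R by lia.
  by rewrite /= [x ^+ n.+2]expgS invgM mulgVK.
Qed.

Lemma expgzD x i j : expgz x (i + j) = expgz x i * expgz x j.
Proof.
elim/int_rec: j => [|n IH|n IH].
- by rewrite addr0 mulg1.
- by rewrite -addn1 PoszD addrA !expgzS IH mulgA.
- apply: (mulIg x); rewrite -mulgA -!expgzS -addn1 PoszD.
  have -> : (i - (Posz n + 1) + 1 = i - Posz n)%R by lia.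
  by have -> : (- (Posz n + 1) + 1 = - Posz n)%R by lia.
Qed.

Lemma expgz_unique x (f : int -> G) i :
  f 0%R = 1 -> (forall j, f (j + 1)%R = f j * x) -> f i = expgz x i.
Proof.
move=> f0 fS; elim/int_rec: i => [//|n IH|n IH]; first by rewrite -addn1 PoszD fS IH expgzS.
apply: (mulIg x); rewrite -fS -expgzS -addn1 PoszD.
by have -> : (- (Posz n + 1) + 1 = - Posz n)%R by lia.
Qed.

Lemma expgzN x i : expgz x (- i) = (expgz x i)^-1.
Proof. by apply/esym/mulg1_eq; rewrite -expgzD subrr. Qed.

Lemma expgzM x i j : expgz x (i * j) = expgz (expgz x i) j.
Proof.
elim/int_rec: j => [|n IH|n IH].
- by rewrite mulr0.
- by rewrite -addn1 PoszD expgzS -IH mulrDr mulr1 expgzD.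
- apply: (mulIg (expgz x i)); rewrite -expgzS -addn1 PoszD -expgzD.
  have -> : (- (Posz n + 1) + 1 = - Posz n)%R by lia.
  by rewrite -IH; congr expgz; lia.
Qed.

Lemma exp1gz i : expgz (1 : G) i = 1.
Proof. by case: i => k /=; rewrite expg1n ?invg1. Qed.

Lemma expgVgz x i : expgz x^-1 i = (expgz x i)^-1.
Proof. by rewrite -[x^-1]/(expgz x (-1)) -expgzM mulN1r expgzN. Qed.

Lemma expgz_absz x i : expgz x `|i|%N = expgz x i \/ expgz x `|i|%N = (expgz x i)^-1.
Proof.
case: (lerP 0 i) => i0; [left|right]; first by rewrite gez0_abs.
by rewrite -expgzN ltz0_abs.
Qed.

Lemma commute_expgz x y i : commute x y -> commute x (expgz y i).
Proof. by case: i => n xy; [|apply: commuteV]; apply: commuteX. Qed.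

End IntegerPowers.

Section Morphisms.
Local Open Scope group_scope.

Section MultiplicativeGroups.
Variables (G H : groupType) (f : {multiplicative G -> H}).

Lemma morph1g : f 1 = 1.
Proof. by apply: (mulgI (f 1)); rewrite -gmulfM !mulg1. Qed.

Lemma morphVg x : f x^-1 = (f x)^-1.
Proof. by apply/esym/mulg1_eq; rewrite -gmulfM mulgV morph1g. Qed.

Lemma morphXg x n : f (x ^+ n) = f x ^+ n.
Proof. by elim: n => [|n IH]; rewrite ?morph1g // !expgS gmulfM IH. Qed.

Lemma morphRg x y : f [~ x, y] = [~ f x, f y].
Proof. by rewrite !gmulfM !morphVg. Qed.

Lemma morph_expgz x i : f (expgz x i) = expgz (f x) i.
Proof. by case: i => n /=; rewrite ?morphVg morphXg. Qed.

End MultiplicativeGroups.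

Lemma multiplicative_of (G H : groupType) (f : G -> H) :
  {morph f : x y / x * y} -> exists g : {multiplicative G -> H}, g =1 f.
Proof.
move=> fM; pose g : Multiplicative.type G H := HB.pack f (isMultiplicative.Build _ _ f fM).
by exists g.
Qed.

Lemma preimage_subgroup (G H : groupType) (f : {multiplicative G -> H}) (K : set H) :
  is_subgroup K -> is_subgroup [set x | K (f x)].
Proof.
move=> sK; split=> [|x y /= Kx Ky]; first by rewrite /= morph1g; exact: sK.1.
by rewrite gmulfM morphVg; apply: sK.2.
Qed.

Lemma subgroupX (G : groupType) (H : set G) x n :
  is_subgroup H -> H x -> H (x ^+ n).
Proof.
move=> sH Hx; elim: n => [|n IH]; first by case: sH.
by rewrite expgS; apply: subgroupM.
Qed.

Lemma subgroup_expgz (G : groupType) (H : set G) x i :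
  is_subgroup H -> H x -> H (expgz x i).
Proof.
by move=> sH Hx; case: i => n /=; [|apply: (subgroupV sH)]; exact: subgroupX.
Qed.

Lemma trivial_subgroup (G : groupType) : is_subgroup [set 1 : G].
Proof. by split=> [//|x y -> ->]; rewrite /set1 /= mulgV. Qed.

End Morphisms.

Section Quotients.
Local Open Scope group_scope.
Variables (G : groupType) (N : normalSubgroup G).
Let Q : groupType := quotient_group N.

Lemma exists_quotient_proj :
  exists f : {multiplicative G -> Q},
    (forall x, f x = \pi_(quotient_group N)%qT x).
Proof. exact: (@multiplicative_of G Q _ (quotient_piM N)). Qed.

Definition quotient_proj : {multiplicative G -> Q} :=
  projT1 (cid exists_quotient_proj).

Lemma quotient_projE x : quotient_proj x = \pi_(quotient_group N)%qT x.
Proof. exact: (projT2 (cid exists_quotient_proj)). Qed.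

Lemma quotient_proj_eq1 x : quotient_proj x = 1 <-> normalSubgroup_set N x.
Proof.
rewrite -(morph1g quotient_proj) !quotient_projE; split=> [/esym|Nx].
  by move/quotient_piP/asboolP; rewrite invg1 mul1g.
by apply/esym/quotient_piP/asboolP; rewrite invg1 mul1g.
Qed.

Lemma quotient_proj_eq x y :
  quotient_proj x = quotient_proj y <-> normalSubgroup_set N (x^-1 * y).
Proof.
rewrite -quotient_proj_eq1 gmulfM morphVg; split=> [->|]; first exact: mulVg.
by move/mulg1_eq; rewrite invgK.
Qed.

Lemma quotient_proj_surj (u : Q) : exists x, quotient_proj x = u.
Proof. by exists (repr u)%qT; rewrite quotient_projE reprK. Qed.

(** The values on the quotient are read off arbitrary preimages, chosen
    classically; triviality on N makes the choice irrelevant. *)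
Lemma quotient_lift (K : groupType) (f : {multiplicative G -> K}) :
  (forall x, normalSubgroup_set N x -> f x = 1) ->
  exists g : {multiplicative Q -> K}, forall x, g (quotient_proj x) = f x.
Proof.
move=> fN.
have fE x y : quotient_proj x = quotient_proj y -> f x = f y.
  by move/quotient_proj_eq/fN; rewrite gmulfM morphVg => /mulg1_eq; rewrite invgK.
pose s (u : Q) := projT1 (cid (quotient_proj_surj u)).
have sK u : quotient_proj (s u) = u := projT2 (cid (quotient_proj_surj u)).
have [g gE] : exists g : {multiplicative Q -> K}, g =1 f \o s.
  apply: multiplicative_of => u v /=; rewrite -gmulfM; apply: fE.
  by rewrite sK gmulfM !sK.
by exists g => x; rewrite gE /=; apply: fE; rewrite sK.
Qed.

End Quotients.

Section FreeLift.
Local Open Scope group_scope.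
Variables (X : choiceType) (K : groupType) (h : X -> K).

Definition word_eval (w : seq (X * bool)) : K :=
  \prod_(l <- w) (if l.2 then (h l.1)^-1 else h l.1).

Lemma word_eval_cat u v : word_eval (u ++ v) = word_eval u * word_eval v.
Proof. exact: big_cat. Qed.

Lemma word_eval_free_eq u v : free_eq u v -> word_eval u = word_eval v.
Proof.
elim=> {u v} [//|u v _ -> //|u v w _ -> _ -> //|u v x e].
rewrite !word_eval_cat; congr (_ * _).
by rewrite /word_eval !big_cons mulgA; case: e => /=; rewrite ?mulgV ?mulVg mul1g.
Qed.

Lemma free_lift :
  exists f : {multiplicative free_group X -> K}, forall x, f (free_gen x) = h x.
Proof.
have evalE w : word_eval (repr (\pi_(free_group X)%qT w)) = word_eval w.
  apply: word_eval_free_eq; have /free_piP/asboolP := reprK (\pi_(free_group X)%qT w).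
  exact.
have [f fE] : exists f : {multiplicative free_group X -> K},
    f =1 fun u => word_eval (repr u).
  by apply: multiplicative_of => u v; rewrite -word_eval_cat -[RHS]evalE.
exists f => x; rewrite fE evalE /word_eval big_seq1 //.
Qed.

Lemma free_group_ind (H : set (free_group X)) :
  is_subgroup H -> (forall x, H (free_gen x)) -> forall u, H u.
Proof.
move=> sH Hgen u; rewrite -[u]reprK; elim: (repr u) => [|[x e] w IHw].
  exact: sH.1.
rewrite -cat1s free_piM; apply: subgroupM IHw => //.
case: e; last exact: Hgen.
have -> : \pi_(free_group X)%qT [:: (x, true)] = (free_gen x)^-1.
  exact: (free_piV [:: (x, false)]).
exact: subgroupV.
Qed.

End FreeLift.

(** * Lower central series and nilpotent quotients of Baumslag-Solitar groups *)

Section LowerCentralSeries.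
Local Open Scope group_scope.
Local Open Scope classical_set_scope.

Lemma subgroup_sub_generated (G : groupType) (A K : set G) :
  is_subgroup K -> A `<=` K -> generated_subgroup A `<=` K.
Proof. by move=> sK AK x; apply. Qed.

Lemma subgroup_lower_central (G : groupType) i : is_subgroup (@lower_central G i).
Proof. exact: (lower_central_normal i).1. Qed.

Lemma lower_central_commg (G : groupType) i (x y : G) :
  lower_central i.+1 y -> lower_central i.+2 [~ x, y].
Proof. by move=> Gy H [_]; apply; exists x => //; exists y. Qed.

Lemma lower_central_commgr (G : groupType) i (x y : G) :
  lower_central i.+1 y -> lower_central i.+2 [~ y, x].
Proof.
move=> Gy; rewrite -invgR; apply: (subgroupV (@subgroup_lower_central G i.+2)).
exact: lower_central_commg.
Qed.

(** The form of induction used for every upper bound on the series: it is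
    enough to catch the commutators inside a subgroup. *)
Lemma lower_central_sub (G : groupType) i (K : set G) :
  is_subgroup K -> (forall x y, lower_central i.+1 y -> K [~ x, y]) ->
  lower_central i.+2 `<=` K.
Proof.
move=> sK Kc; apply: subgroup_sub_generated => // _ [x _ [y Gy <-]]; exact: Kc.
Qed.

Lemma lower_centralS (G : groupType) i :
  @lower_central G i.+2 `<=` lower_central i.+1.
Proof.
apply: lower_central_sub; first exact: subgroup_lower_central.
move=> x y Gy; rewrite commgEr.
have [sG nG] := @lower_central_normal G i.+1.
by apply: subgroupM => //; apply: nG; apply: subgroupV.
Qed.

Lemma lower_central_morph (G H : groupType) (f : {multiplicative G -> H}) i x :
  lower_central i x -> lower_central i (f x).
Proof.
case: i => [//|i]; elim: i x => [//|i IH] x.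
apply: (@lower_central_sub G i [set x | lower_central i.+2 (f x)]) x.
  exact/preimage_subgroup/subgroup_lower_central.
by move=> x y /IH Hfy /=; rewrite morphRg; apply: lower_central_commg.
Qed.

Lemma lower_central_surj (G H : groupType) (f : {multiplicative G -> H}) i :
  (forall y, exists x, f x = y) ->
  @lower_central H i `<=` f @` lower_central i.
Proof.
move=> fsurj; case: i => [|i]; first by move=> y _; have [x] := fsurj y; exists x.
elim: i => [|i IH]; first by move=> y _; have [x] := fsurj y; exists x.
have sG := @subgroup_lower_central G i.+2.
apply: lower_central_sub => [|x y /IH[v Gv <-]].
  split; first by exists 1; [exact: sG.1|exact: morph1g].
  move=> _ _ [x Gx <-] [y Gy <-]; exists (x / y); first exact: sG.2.
  by rewrite gmulfM morphVg.
have [u <-] := fsurj x; exists [~ u, v]; last exact: morphRg.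
exact: lower_central_commg.
Qed.

End LowerCentralSeries.

Section NilpotentQuotient.
Local Open Scope group_scope.
Local Open Scope classical_set_scope.

(** The class-c quotient is cut out by the term of index c.+1, as the series
    starts at index 1. *)
Definition nilpotent_quotient (G : groupType) (c : nat) : groupType :=
  quotient_group (lower_central_nsg G c.+1).

Lemma nilpotent_quotient_lower_central (G : groupType) c (u : nilpotent_quotient G c) :
  lower_central c.+1 u -> u = 1.
Proof.
move=> /(lower_central_surj (@quotient_proj_surj G _)) [x Gx <-].
exact/quotient_proj_eq1.
Qed.

Lemma nilpotent_quotient_lift (G K : groupType) c (f : {multiplicative G -> K}) :
  @lower_central K c.+1 `<=` [set 1] ->
  exists g : {multiplicative nilpotent_quotient G c -> K},
    forall x, g (quotient_proj _ x) = f x.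
Proof.
move=> K1; apply: quotient_lift => x Gx; apply: K1.
exact: lower_central_morph.
Qed.

End NilpotentQuotient.

Section BaumslagSolitar.
Local Open Scope group_scope.
Local Open Scope classical_set_scope.
Variables m n : int.

Definition BSa : BS m n := quotient_proj _ (free_gen true).
Definition BSb : BS m n := quotient_proj _ (free_gen false).

Lemma BS_relation : BSa^-1 * expgz BSb m * BSa = expgz BSb n.
Proof.
apply: divg1_eq; rewrite -!morph_expgz -!morphVg -!gmulfM.
apply/quotient_proj_eq1 => N [_]; apply; exact: erefl.
Qed.

Lemma BS_lift (K : groupType) (A B : K) :
  A^-1 * expgz B m * A = expgz B n ->
  exists f : {multiplicative BS m n -> K}, f BSa = A /\ f BSb = B.
Proof.
move=> AB; have [f fE] := free_lift (fun e : bool => if e then A else B).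
have sker : is_normal_subgroup [set x | f x = 1].
  split=> [|x g /= fx]; first exact: (preimage_subgroup f (trivial_subgroup K)).
  by rewrite conjgE !gmulfM morphVg fx mul1g mulVg.
have [g gE] : exists g : {multiplicative BS m n -> K}, forall x, g (quotient_proj _ x) = f x.
  apply: quotient_lift => x /= Nx; apply: (Nx [set x | f x = 1]).
  split=> // _ ->; rewrite /= !gmulfM !morphVg !morph_expgz !fE AB.
  exact: mulgV.
by exists g; rewrite !gE !fE.
Qed.

Lemma BS_ind (H : set (BS m n)) :
  is_subgroup H -> H BSa -> H BSb -> forall x, H x.
Proof.
move=> sH Ha Hb x; have [u <-] := quotient_proj_surj x.
apply: (@free_group_ind _ [set u | H (quotient_proj _ u)]) u.
  exact: preimage_subgroup.
by case.
Qed.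

Variable c : nat.
Notation Q := (nilpotent_quotient (BS m n) c).

Definition nilBSa : Q := quotient_proj _ BSa.
Definition nilBSb : Q := quotient_proj _ BSb.

Lemma nilBS_relation : nilBSa^-1 * expgz nilBSb m * nilBSa = expgz nilBSb n.
Proof.
rewrite /nilBSa /nilBSb; set q := quotient_proj _.
by rewrite -!(morph_expgz q) -(morphVg q) -!gmulfM BS_relation.
Qed.

(** Among groups of class at most c, the quotient of BS(m, n) is presented by
    the same generators and relation; both its automorphisms and its
    representations come from here. *)
Lemma nilBS_lift (K : groupType) (A B : K) :
  A^-1 * expgz B m * A = expgz B n -> @lower_central K c.+1 `<=` [set 1] ->
  exists f : {multiplicative Q -> K}, f nilBSa = A /\ f nilBSb = B.
Proof.
move=> /BS_lift[f [fa fb]] /(nilpotent_quotient_lift f)[g gE].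
by exists g; rewrite !gE.
Qed.

Lemma nilBS_ind (H : set Q) :
  is_subgroup H -> H nilBSa -> H nilBSb -> forall x, H x.
Proof.
move=> sH Ha Hb x; have [u <-] := quotient_proj_surj x.
apply: (@BS_ind [set u | H (quotient_proj _ u)]) u => //.
exact: preimage_subgroup.
Qed.

End BaumslagSolitar.

(** * Finiteness of the derived subgroup of a nilpotent quotient *)

Section CommutatorCalculus.
Local Open Scope group_scope.
Local Open Scope classical_set_scope.
Variable G : groupType.
Implicit Types (x y z : G) (N : set G).

Lemma commgMr x y z : [~ x, y * z] = [~ x, z] * [~ x, y] ^ z.
Proof. by rewrite !commgEl !conjgE !gnorm. Qed.

Lemma commgMl x y z : [~ x * y, z] = [~ x, z] ^ y * [~ y, z].
Proof. by rewrite !commgEl !conjgE !gnorm. Qed.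

Lemma commgVr x y : [~ x, y^-1] = ([~ x, y] ^ y^-1)^-1.
Proof. by apply/divg1_eq; rewrite invgK -commgMr mulgV commg1. Qed.

Lemma commgVl x y : [~ x^-1, y] = ([~ x, y] ^ x^-1)^-1.
Proof. by apply/esym/mulg1_eq; rewrite -commgMl mulgV comm1g. Qed.

Lemma commgX x y k : commute [~ x, y] y -> [~ x, y ^+ k] = [~ x, y] ^+ k.
Proof.
move=> cxy; elim: k => [|k IH]; first by rewrite commg1.
rewrite expgSr commgMr IH expgS; congr (_ * _).
by apply/conjg_fixP/commgP; apply/commute_sym/commuteX/commute_sym.
Qed.

Variables (i : nat) (N : set G).
Hypotheses (sN : is_subgroup N) (GN : @lower_central G i.+3 `<=` N).

(** Conjugation moves an element of gamma_(i+2) by a factor in gamma_(i+3),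
    so it is invisible to any subgroup containing gamma_(i+3). *)
Lemma conj_mod_lower_central g u : lower_central i.+2 g -> N g -> N (g ^ u).
Proof.
move=> Gg Ng; rewrite -(mulVKg g (g ^ u)) -commgEl.
apply: (subgroupM sN) Ng _; apply: GN.
exact: lower_central_commgr.
Qed.

(** The commutator map is bilinear on G x gamma_(i+1) modulo gamma_(i+3). As
    N contains the error terms, membership of commutators in N propagates from
    generators in each argument. *)
Lemma subgroup_commg_right x :
  is_subgroup [set y | lower_central i.+1 y /\ N [~ x, y]].
Proof.
have sG := @subgroup_lower_central G i.+1.
split=> [|y z [Gy Ny] [Gz Nz]] /=.
  by rewrite commg1; split; [exact: sG.1|exact: sN.1].
split; first exact: sG.2.
rewrite commgMr commgVr; apply: subgroupM => //.
  apply: subgroupV => //; apply: conj_mod_lower_central => //.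
  exact: lower_central_commg.
by apply: conj_mod_lower_central => //; exact: lower_central_commg.
Qed.

Lemma subgroup_commg_left y :
  lower_central i.+1 y -> is_subgroup [set x | N [~ x, y]].
Proof.
move=> Gy; split=> [|x z Nx Nz] /=; first by rewrite comm1g; exact: sN.1.
rewrite commgMl commgVl; apply: subgroupM => //.
  by apply: conj_mod_lower_central => //; exact: lower_central_commg.
apply: subgroupV => //; apply: conj_mod_lower_central => //.
exact: lower_central_commg.
Qed.

End CommutatorCalculus.

Section FiniteCommutatorSubgroup.
Local Open Scope group_scope.
Local Open Scope classical_set_scope.
Variables (G : groupType) (a b : G).
Hypothesis gen : forall H : set G, is_subgroup H -> H a -> H b -> forall x, H x.

(** Generation of gamma_(i+1) / gamma_(i+2), phrased with subgroups of G so that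
    it can be fed directly with the subgroups of the bilinearity lemmas. *)
Definition generates_mod (i : nat) (s : seq G) : Prop :=
  (forall y, y \in s -> lower_central i.+1 y) /\
  forall N : set G, is_subgroup N -> (forall y, y \in s -> N y) ->
    @lower_central G i.+2 `<=` N -> @lower_central G i.+1 `<=` N.

(** By bilinearity, the commutators of a and b with generators of one factor of
    the series generate the next factor. *)
Lemma exists_generates_mod i : exists s, generates_mod i s.
Proof.
elim: i => [|i [s [Gs gens]]].
  exists [:: a; b]; split=> // N sN Ns _ x _.
  by apply: (gen sN); apply: Ns; rewrite !inE eqxx ?orbT.
exists ([seq [~ a, y] | y <- s] ++ [seq [~ b, y] | y <- s]); split.
  by move=> y; rewrite mem_cat => /orP[] /mapP[z /Gs Gz ->]; apply: lower_central_commg.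
move=> N sN Ns GN.
have Nab x y : x = a \/ x = b -> lower_central i.+1 y -> N [~ x, y].
  move=> xab Gy.
  have sub : @lower_central G i.+1 `<=` [set y | lower_central i.+1 y /\ N [~ x, y]].
    apply: gens; first exact: subgroup_commg_right.
      move=> z zs; split; first exact: Gs.
      apply: Ns; rewrite mem_cat; case: xab => ->.
        by rewrite map_f.
      by rewrite [X in _ || X]map_f ?orbT.
    move=> z Gz; split; first exact: lower_centralS.
    by apply: GN; apply: lower_central_commg.
  by have [] := sub y Gy.
apply: lower_central_sub => // x y Gy.
apply: (gen (subgroup_commg_left sN GN Gy)) => /=; apply: Nab => //; [left|right]; done.
Qed.

Lemma commute_mod_lower_central i (x y : G) :
  lower_central i.+1 x ->
  commute (quotient_proj (lower_central_nsg G i.+2) x)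
          (quotient_proj (lower_central_nsg G i.+2) y).
Proof.
move=> Gx; apply/commgP/eqP; rewrite -morphRg; apply/quotient_proj_eq1.
exact: lower_central_commgr.
Qed.

Lemma subgroup_torsion_mod i M :
  is_subgroup [set g : G | lower_central i.+1 g /\ lower_central i.+2 (g ^+ M)].
Proof.
have sG := @subgroup_lower_central G i.+1.
have sG' := @subgroup_lower_central G i.+2.
split=> [|x y [Gx Mx] [Gy My]] /=; first by rewrite expg1n; split; [exact: sG.1|exact: sG'.1].
split; first exact: sG.2.
apply/(quotient_proj_eq1 (lower_central_nsg G i.+2)).
rewrite morphXg gmulfM morphVg expgnFl; last exact: commute_mod_lower_central.
rewrite -!morphXg.
move/(quotient_proj_eq1 (lower_central_nsg G i.+2)): Mx => ->.
move/(quotient_proj_eq1 (lower_central_nsg G i.+2)): My => ->.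
exact: mulgV.
Qed.

(** By bilinearity, torsion in one factor of the series passes to all later
    ones: the M-th power of [x, y] is [x, y ^ M] up to a deeper term. The first
    factor of interest, gamma_2 / gamma_3, is generated by [a, b] alone. *)
Lemma lower_central_exponent M i (g : G) :
  @lower_central G 3 ([~ a, b] ^+ M) ->
  lower_central i.+2 g -> lower_central i.+3 (g ^+ M).
Proof.
move=> abM; pose N j := [set g : G | lower_central j.+2 g /\ lower_central j.+3 (g ^+ M)].
have sN j : is_subgroup (N j) by exact: subgroup_torsion_mod.
have GN j : @lower_central G j.+3 `<=` N j.
  move=> x Gx; split; first exact: lower_centralS.
  exact: (subgroupX _ (@subgroup_lower_central G j.+3)).
suff GNi j : @lower_central G j.+2 `<=` N j by move=> /GNi[].
elim: j => [|j IH].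
  apply: lower_central_sub => // x y _.
  have Nab : N 0%N [~ a, b] by split=> //; exact: lower_central_commg.
  have Nba : N 0%N [~ b, a] by rewrite -invgR; apply: subgroupV.
  have Ng z : N 0%N [~ z, z] by rewrite commgg; exact: (sN 0%N).1.
  have Nl z : z = a \/ z = b -> N 0%N [~ x, z].
    by move=> zab; apply: (gen (subgroup_commg_left (sN 0%N) (GN 0%N) (y := z) _));
       case: zab => -> //=.
  have := gen (subgroup_commg_right (sN 0%N) (GN 0%N) x).
  move=> /(_ _ _ y)[]//; split=> //; apply: Nl; [left|right]; done.
apply: lower_central_sub => // x y Gy; split; first exact: lower_central_commg.
have [_ yM] := IH _ Gy.
apply/(quotient_proj_eq1 (lower_central_nsg G j.+4)).
rewrite morphXg morphRg -commgX -?morphXg -?morphRg.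
  by apply/quotient_proj_eq1; apply: lower_central_commg.
by apply: commute_mod_lower_central; apply: lower_central_commg.
Qed.

(** Central elements of exponent M generate the products of their powers with
    exponents below M. *)
Lemma finite_central_torsion (K : groupType) (s : seq K) M :
  (0 < M)%N -> (forall x y, x \in s -> commute x y) ->
  (forall x, x \in s -> x ^+ M = 1) ->
  exists P : set K, [/\ finite_set P, is_subgroup P & forall x, x \in s -> P x].
Proof.
move=> M0; elim: s => [|x s IH] cs sM.
  exists [set 1]; split=> //; exact: trivial_subgroup.
have [y z ys|y ys|P [finP sP Ps]] := IH.
- by apply: cs; rewrite inE ys orbT.
- by apply: sM; rewrite inE ys orbT.
have cx y : commute x y by apply: cs; rewrite mem_head.
have xM : x ^+ M = 1 by apply: sM; rewrite mem_head.
have xmod k : x ^+ (k %% M) = x ^+ k.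
  by rewrite [in RHS](divn_eq k M) expgnDr mulnC expgnA xM expg1n mul1g.
exists [set x ^+ k * p | k in `I_M & p in P]; split.
- exact: (finite_image2 (fun k p => x ^+ k * p) (finite_II M) finP).
- split; first by exists 0%N => //; exists 1; [exact: sP.1|rewrite mulg1].
  move=> _ _ [k kM [p Pp <-]] [l lM [q Pq <-]].
  exists ((k + (M - l)) %% M)%N; first by rewrite /= ltn_mod.
  exists (p / q); first exact: sP.2.
  rewrite xmod expgnDr expgnFr ?(ltnW lM) // xM mul1g invgM -!mulgA.
  congr (_ * _); rewrite [RHS]mulgA.
  exact/commute_sym/commuteV/commuteX/commute_sym/cx.
- move=> y; rewrite inE => /predU1P[->|ys].
    exists (1 %% M)%N; first by rewrite /= ltn_mod.
    by exists 1; [exact: sP.1|rewrite xmod mulg1].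
  by exists 0%N => //; exists y; [exact: Ps|rewrite mul1g].
Qed.

Lemma finite_lower_central_factor M i : (0 < M)%N ->
  @lower_central G 3 ([~ a, b] ^+ M) ->
  exists2 C : set G, finite_set C &
    forall g, lower_central i.+2 g -> exists2 c, C c & lower_central i.+3 (c^-1 * g).
Proof.
move=> M0 abM; have [s [Gs gens]] := exists_generates_mod i.+1.
pose q := quotient_proj (lower_central_nsg G i.+3).
have [||P [finP sP Ps]] := @finite_central_torsion _ (map q s) M M0.
- move=> _ u /mapP[x /Gs Gx ->]; have [y <-] := quotient_proj_surj u.
  exact: commute_mod_lower_central.
- move=> _ /mapP[x /Gs Gx ->]; rewrite -morphXg; apply/quotient_proj_eq1.
  exact: lower_central_exponent.
exists ((fun u => projT1 (cid (quotient_proj_surj u))) @` P); first exact: finite_image.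
move=> g Gg; exists (projT1 (cid (quotient_proj_surj (q g)))).
  exists (q g) => //; apply: (gens [set x | P (q x)]) => //.
  - exact: preimage_subgroup.
  - by move=> y ys; apply: Ps; rewrite map_f.
  - move=> x Gx /=; rewrite (_ : q x = 1); first exact: sP.1.
    exact/quotient_proj_eq1.
by case: cid => x /= qx; apply/(quotient_proj_eq (lower_central_nsg G i.+3)).
Qed.

(** Each factor gamma_i / gamma_(i+1) with i at least 2 is abelian, finitely
    generated and of exponent dividing M, hence finite, and there are finitely
    many of them before the series vanishes. *)
Lemma finite_derived_subgroup M c : (0 < M)%N ->
  @lower_central G 3 ([~ a, b] ^+ M) ->
  @lower_central G c.+1 `<=` [set 1] -> finite_set (@lower_central G 2).
Proof.
move=> M0 abM Gc.
suff H i : exists2 C : set G, finite_set C &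
    forall g, lower_central 2 g -> exists2 c, C c & lower_central i.+2 (c^-1 * g).
  have [C finC CG] := H c; apply: sub_finite_set finC => g /CG[x Cx].
  by move=> /lower_centralS/Gc/mulg1_eq; rewrite invgK => <-.
elim: i => [|i [C finC CG]].
  exists [set 1]; first exact: finite_set1.
  by move=> g Gg; exists 1 => //; rewrite invg1 mul1g.
have [D finD DG] := finite_lower_central_factor i M0 abM.
exists [set x * y | x in C & y in D]; first exact: (finite_image2 (fun x y => x * y)).
move=> g /CG[x Cx /DG[y Dy Gy]]; exists (x * y); first by exists x => //; exists y.
by rewrite invgM -mulgA.
Qed.

End FiniteCommutatorSubgroup.

(** * Counting twisted conjugacy classes *)

Section Reidemeister.
Local Open Scope group_scope.
Local Open Scope classical_set_scope.
Variables (G : groupType) (phi : {multiplicative G -> G}).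

Lemma finite_Reidemeister (C : set G) :
  finite_set C -> (forall x, exists z, C (z * x * (phi z)^-1)) ->
  finite_set (Reidemeister_classes phi).
Proof.
move=> finC CP.
apply: sub_finite_set (finite_image (fun y => [set x | twisted_conj phi x y]) finC).
move=> _ [y _ <-]; have [z Cz] := CP y; exists (z * y * (phi z)^-1) => //.
apply/seteqP; split=> x [w ->].
  by exists (w * z); rewrite gmulfM invgM !mulgA.
by exists (w / z); rewrite gmulfM morphVg invgM invgK !mulgA mulgVK mulgVK.
Qed.

(** Finiteness of the number of twisted classes may be tested modulo a finite
    normal subgroup, here the derived subgroup. *)
Lemma finite_Reidemeister_mod_derived (C : set G) :
  finite_set C -> finite_set (@lower_central G 2) ->
  (forall x, exists z, exists2 y, C y & lower_central 2 (y^-1 * (z * x * (phi z)^-1))) ->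
  finite_set (Reidemeister_classes phi).
Proof.
move=> finC finG CP.
apply: (@finite_Reidemeister [set y * g | y in C & g in lower_central 2]).
  exact: (finite_image2 (fun x y => x * y)).
move=> x; have [z [y Cy Gy]] := CP x; exists z; exists y => //.
by eexists; first exact: Gy; rewrite mulVKg.
Qed.

Lemma infinite_Reidemeister_invariant (e : G -> int) :
  (forall z y, e (z * y * (phi z)^-1) = e y) ->
  (forall k : nat, exists x, e x = k) ->
  infinite_set (Reidemeister_classes phi).
Proof.
move=> einv esurj.
pose s k := projT1 (cid (esurj k)); have sE k : e (s k) = k := projT2 (cid (esurj k)).
pose f k := [set x | twisted_conj phi x (s k)].
have finj : injective f.
  move=> k l /seteqP[fkl _]; have [|z skl] := fkl (s k).
    by exists 1; rewrite morph1g invg1 mulg1 mul1g.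
  by apply/eqP; have := sE k; rewrite skl einv sE => -[->].
move=> fin; apply: infinite_nat.
have := sub_finite_set _ fin (A := f @` setT).
rewrite (eq_finite_set (inj_card_eq _)); last by move=> k l _ _; exact: finj.
by apply => _ [k _ <-]; exists (s k).
Qed.

End Reidemeister.

(** * Automorphisms inverting a have finitely many twisted classes *)

Section InvertingAutomorphisms.
Local Open Scope group_scope.
Local Open Scope classical_set_scope.
Variables (G : groupType) (a b : G).
Hypothesis gen : forall H : set G, is_subgroup H -> H a -> H b -> forall x, H x.

Let ab : {multiplicative G -> _} := quotient_proj (lower_central_nsg G 2).

Lemma abelianization_mulgC u v : u * v = v * u :> quotient_group (lower_central_nsg G 2).
Proof.
have [x <-] := quotient_proj_surj u; have [y <-] := quotient_proj_surj v.
exact: commute_mod_lower_central.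
Qed.

Lemma abelianization_powers x :
  exists i j : int, ab x = expgz (ab a) i * expgz (ab b) j.
Proof.
apply: (gen (H := [set x | exists i j : int, ab x = expgz (ab a) i * expgz (ab b) j])).
- split=> [|u v [i [j uE]] [k [l vE]]]; first by exists 0%R, 0%R; rewrite morph1g mulg1.
  exists (i - k)%R, (j - l)%R; rewrite gmulfM morphVg uE vE !expgzD !expgzN.
  rewrite invgM -!mulgA; congr (_ * _); rewrite mulgA; exact: abelianization_mulgC.
- by exists 1%R, 0%R; rewrite /= expg1 mulg1.
- by exists 0%R, 1%R; rewrite /= expg1 mul1g.
Qed.

Lemma lower_central_commg_torsion M :
  lower_central 3 [~ a, b ^+ M] -> @lower_central G 3 ([~ a, b] ^+ M).
Proof.
move=> abM; apply/(quotient_proj_eq1 (lower_central_nsg G 3)).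
rewrite morphXg morphRg -commgX -?morphXg -?morphRg.
  exact/quotient_proj_eq1.
by apply: commute_mod_lower_central; apply: lower_central_commg.
Qed.

(** Twisting by a ^ l replaces a ^ i by a ^ (i + 2 l) modulo gamma_2, which
    leaves two values of i; the last hypothesis is the analogous bound for the
    powers of b, which holds for different reasons when b is torsion and when
    it is inverted. *)
Lemma finite_Reidemeister_inversion (phi : {multiplicative G -> G}) M K c :
  (0 < M)%N -> @lower_central G 3 ([~ a, b] ^+ M) ->
  @lower_central G c.+1 `<=` [set 1] -> phi a = a^-1 ->
  (forall j, exists q : int, exists2 k, (k < K)%N &
     ab (expgz b q * expgz b j * (phi (expgz b q))^-1) = ab (b ^+ k)) ->
  finite_set (Reidemeister_classes phi).
Proof.
move=> M0 abM Gc phia phib.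
apply: (@finite_Reidemeister_mod_derived _ phi [set a ^+ e * b ^+ k | e in `I_2 & k in `I_K]).
- by apply: (finite_image2 (fun e k => a ^+ e * b ^+ k)); exact: finite_II.
- exact: finite_derived_subgroup abM Gc.
move=> x; have [i [j xE]] := abelianization_powers x; have [q [k kM bqE]] := phib j.
pose l := (- (i %/ 2)%Z)%R; pose e := `|(i %% 2)%Z|%N.
have e2 : (e < 2)%N by rewrite /e; lia.
have iE : (l + i + l = e%:Z)%R by rewrite /l /e; lia.
exists (expgz a l * expgz b q); exists (a ^+ e * b ^+ k); first by exists e => //; exists k.
apply/(quotient_proj_eq (lower_central_nsg G 2)); rewrite -/ab.
have aE : a ^+ e = expgz a l * expgz a i * expgz a l by rewrite -!expgzD iE.
have phi_al : (phi (expgz a l))^-1 = expgz a l.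
  by rewrite morph_expgz phia expgVgz invgK.
rewrite [phi _]gmulfM invgM phi_al [LHS]gmulfM -bqE aE !gmulfM xE !morph_expgz -!mulgA.
congr (_ * _); rewrite [RHS]mulgA [_ * expgz (ab a) i]abelianization_mulgC -mulgA.
by congr (_ * _); rewrite abelianization_mulgC -!mulgA.
Qed.

End InvertingAutomorphisms.

Section NilpotentInversions.
Local Open Scope group_scope.
Local Open Scope classical_set_scope.

Lemma nilBS_involution m n c
    (phi : {multiplicative nilpotent_quotient (BS m n) c -> nilpotent_quotient (BS m n) c}) :
  phi (phi (nilBSa m n c)) = nilBSa m n c -> phi (phi (nilBSb m n c)) = nilBSb m n c ->
  bijective phi.
Proof.
move=> phia phib; have phiK x : phi (phi x) = x.
  apply: (nilBS_ind (H := [set x | phi (phi x) = x])) => //.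
  split=> [|u v /= uE vE]; first by rewrite /= !morph1g.
  by rewrite !gmulfM !morphVg uE vE.
by exists phi.
Qed.

(** The extra relation says exactly that a may be replaced by its inverse while
    b is fixed. Since b ^ (n - m) = [b ^ m, a], the element b is torsion modulo
    gamma_2, which gives both the finiteness of gamma_2 and the finiteness of
    the powers of b. *)
Lemma not_Rinfty_neq m n c :
  m <> n ->
  nilBSa m n c * expgz (nilBSb m n c) m * (nilBSa m n c)^-1 = expgz (nilBSb m n c) n ->
  ~ has_Rinfty (nilpotent_quotient (BS m n) c).
Proof.
set a := nilBSa m n c; set b := nilBSb m n c => mn aba RQ.
have gen := @nilBS_ind m n c.
have Qc := @nilpotent_quotient_lower_central (BS m n) c.
have rel : a^-1 * expgz b m * a = expgz b n := nilBS_relation m n c.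
have [||phi [phia phib]] := @nilBS_lift m n c (nilpotent_quotient (BS m n) c) a^-1 b => //.
  by rewrite invgK.
pose M := `|(n - m)%R|%N.
have M0 : (0 < M)%N by rewrite /M; lia.
have bM : lower_central 2 (b ^+ M).
  have bnm : lower_central 2 (expgz b (n - m)).
    rewrite addrC expgzD expgzN -rel -mulgA -commgEl.
    exact: (@lower_central_commg _ 0).
  rewrite -[b ^+ M]/(expgz b M); have [->|->] := expgz_absz b (n - m) => //.
  exact: (subgroupV (@subgroup_lower_central _ 2)).
apply: (RQ phi).
  by apply: nilBS_involution; rewrite ?phia ?phib ?morphVg ?phia ?invgK.
apply: (finite_Reidemeister_inversion (K := M) (c := c) gen M0) => //.
  by apply: lower_central_commg_torsion; exact: (@lower_central_commg _ 1).
move=> j; exists 0%R, `|(j %% M)%Z|%N; first by lia.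
rewrite mul1g morph1g invg1 mulg1; apply/quotient_proj_eq.
rewrite -[b ^+ _]/(expgz b (Posz _)) -expgzN -expgzD.
have -> : (- j + `|(j %% M)%Z|%N = Posz M * - (j %/ M)%Z)%R by lia.
rewrite expgzM; exact: (subgroup_expgz _ (@subgroup_lower_central _ 2) bM).
Qed.

(** When m = n, inverting both generators preserves the relation in BS(m, m)
    itself. Here b has infinite order modulo gamma_2, but its powers are reduced
    modulo squares just as those of a; and gamma_2 is finite as b ^ m is
    central. *)
Lemma not_Rinfty_eq m c : m <> 0%R -> ~ has_Rinfty (nilpotent_quotient (BS m m) c).
Proof.
set a := nilBSa m m c; set b := nilBSb m m c => m0 RQ.
have gen := @nilBS_ind m m c.
have Qc := @nilpotent_quotient_lower_central (BS m m) c.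
have abm : commute a (expgz b m).
  by rewrite /commute -{1}(nilBS_relation m m c) -!mulgA mulVKg.
have [||phi [phia phib]] := @nilBS_lift m m c (nilpotent_quotient (BS m m) c) a^-1 b^-1 => //.
  by rewrite invgK expgVgz (commuteV abm) mulgK.
pose M := `|m|%N.
have M0 : (0 < M)%N by rewrite /M; lia.
apply: (RQ phi).
  apply: nilBS_involution; first by rewrite phia morphVg phia invgK.
  by rewrite phib morphVg phib invgK.
have abM : commute a (b ^+ M).
  rewrite -[b ^+ M]/(expgz b M); have [->|->] := expgz_absz b m => //.
  exact: commuteV.
apply: (finite_Reidemeister_inversion (K := 2) (c := c) gen M0) => //.
  apply: lower_central_commg_torsion; move/commgP/eqP: abM => ->.
  exact: (subgroup1 (@subgroup_lower_central _ 3)).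
move=> j; exists (- (j %/ 2)%Z)%R, `|(j %% 2)%Z|%N; first by lia.
congr (quotient_proj _ _); rewrite morph_expgz phib expgVgz invgK -!expgzD.
by rewrite -[RHS]/(expgz b (Posz _)); congr expgz; lia.
Qed.

End NilpotentInversions.

(** * Unipotent affine groups *)

(** The semidirect product of Z with the additive group of E, the generator of Z
    acting by right multiplication by the unit T. The ring E need not be
    commutative, so that T may be a matrix. *)
Definition affine_group (E : unitRingType) (T : E) (unitT : T \is a GRing.unit) : Type :=
  (int * E)%type.

Section AffineGroup.
Variables (E : unitRingType) (T : E) (unitT : T \is a GRing.unit).
Local Open Scope ring_scope.
Local Open Scope classical_set_scope.

Notation affine_group := (affine_group unitT).

HB.instance Definition _ := Choice.on affine_group.

Implicit Types x y : affine_group.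

Definition affine_mul x y : affine_group := (x.1 + y.1, x.2 * T ^ y.1 + y.2).
Definition affine_inv x : affine_group := (- x.1, - x.2 * T ^ (- x.1)).
Definition affine_one : affine_group := (0, 0).

Lemma affine_mulA : associative affine_mul.
Proof.
move=> x y z; rewrite /affine_mul /=; congr (_, _); first exact: addrA.
by rewrite mulrDl exprzDr // mulrA addrA.
Qed.

Lemma affine_mul1 : left_id affine_one affine_mul.
Proof. by case=> z v; rewrite /affine_mul /= add0r mul0r add0r. Qed.

Lemma affine_mulr1 : right_id affine_one affine_mul.
Proof. by case=> z v; rewrite /affine_mul /= !addr0 mulr1. Qed.

Lemma affine_mulV : left_inverse affine_one affine_inv affine_mul.
Proof.
case=> z v; rewrite /affine_mul /= addNr -mulrA -exprzDr // addNr mulr1.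
by rewrite addNr.
Qed.

Lemma affine_mulrV : right_inverse affine_one affine_inv affine_mul.
Proof. by case=> z v; rewrite /affine_mul /= subrr -mulrDl subrr mul0r. Qed.

HB.instance Definition _ := isGroup.Build affine_group
  affine_mulA affine_mul1 affine_mulr1 affine_mulV affine_mulrV.

Lemma affine_mulE x y : (x * y)%g = (x.1 + y.1, x.2 * T ^ y.1 + y.2).
Proof. by []. Qed.

Lemma affine_invE x : (x^-1)%g = (- x.1, - x.2 * T ^ (- x.1)).
Proof. by []. Qed.

Lemma affine_expgz_fst x i : (expgz x i).1 = i * x.1.
Proof.
have H n : (x ^+ n)%g.1 = n%:Z * x.1.
  elim: n => [|n IH]; first by rewrite mul0r.
  by rewrite expgSr affine_mulE /= IH -addn1 PoszD mulrDl mul1r.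
case: i => n; first exact: H.
have -> : expgz x (Negz n) = (x ^- n.+1)%g by [].
by rewrite affine_invE /= H NegzE mulNr.
Qed.

Lemma affine_expgz (v : E) i : expgz ((0, v) : affine_group) i = (0, v *~ i).
Proof.
apply/esym; apply: (expgz_unique (f := fun i => (0, v *~ i) : affine_group)) => // j.
by rewrite affine_mulE /= mulr1 mulrzDr.
Qed.

Lemma affine_commg x y :
  [~ x, y]%g = (0, x.2 * (T ^ y.1 - 1) - y.2 * (T ^ x.1 - 1)).
Proof.
have -> : [~ x, y]%g = ((y * x)^-1 * (x * y))%g by rewrite commgEl conjgE invgM !mulgA.
rewrite !affine_mulE affine_invE /=; congr (_, _); first by ring.
rewrite -[y.1 + x.1]addrC -mulrA -exprzDr // addNr mulr1 !mulrBr !mulr1.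
by rewrite opprD opprB [LHS]addrC [X in _ + X]addrC addrACA.
Qed.

Lemma commr_exprz z (s : E) : GRing.comm s T -> GRing.comm s (T ^ z).
Proof.
by case: z => n sT; [|rewrite NegzE -exprnN; apply: commrV]; apply: commrX.
Qed.

Lemma exprz_subr1 z : exists C, T ^ z - 1 = C * (T - 1).
Proof.
have H n : exists C, T ^+ n - 1 = C * (T - 1).
  elim: n => [|n [C CE]]; first by exists 0; rewrite subrr mul0r.
  by exists (T * C + 1); rewrite mulrDl mul1r -mulrA -CE mulrBr mulr1 exprS addrA subrK.
case: z => n; first exact: H.
have [C CE] := H n.+1; exists (- (T ^- n.+1 * C)).
by rewrite NegzE -exprnN mulNr -mulrA -CE mulrBr mulr1 mulVr ?unitrX // opprB.
Qed.

(** Forming commutators costs one more factor T - 1, since T ^ z - 1 is always a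
    multiple of T - 1. Hence a unipotent T gives a nilpotent group. *)
Lemma affine_lower_central i x :
  lower_central i.+2 x -> x.1 = 0 /\ exists u, x.2 = u * (T - 1) ^+ i.+1.
Proof.
pose K i := [set x : affine_group |
  ((0 < i)%N -> x.1 = 0) /\ exists u, x.2 = u * (T - 1) ^+ i].
have sK j : is_subgroup (K j).
  split; first by split=> //; exists 0; rewrite mul0r.
  move=> p q [p1 [u pu]] [q1 [v qv]]; rewrite affine_invE affine_mulE; split=> /=.
    by move=> j0; rewrite p1 // q1.
  exists ((u - v) * T ^ (- q.1)); rewrite -mulrDl pu qv -mulrBl -!mulrA; congr (_ * _).
  apply: commr_exprz; apply/commr_sym/commrX/commrB; [exact: commr_refl|exact: commr1].
suff sub : lower_central i.+2 `<=` K i.+1 by move=> /sub [-> // ?].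
elim: i => [|i IH] {x}.
  apply: lower_central_sub => // x y _; rewrite affine_commg; split=> //=.
  have [C ->] := exprz_subr1 y.1; have [D ->] := exprz_subr1 x.1.
  by exists (x.2 * C - y.2 * D); rewrite expr1 mulrBl !mulrA.
apply: lower_central_sub => // x y /IH[y1 [u yu]]; rewrite affine_commg; split=> //=.
have [C CE] := exprz_subr1 x.1.
exists (- (u * C)); have -> : T ^ y.1 = 1 by rewrite y1.
rewrite yu subrr mulr0 sub0r mulNr -!mulrA.
congr (- (u * _)); rewrite [in RHS]exprS mulrA -CE.
apply: commrB; last exact: commr1.
apply: commr_exprz; apply/commr_sym/commrX/commrB; [exact: commr_refl|exact: commr1].
Qed.

End AffineGroup.

(** * A unipotent representation of BS(m, n) *)

Section ShiftMatrix.
Local Open Scope ring_scope.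
Variables (R : comUnitRingType) (c : nat).
Local Notation E := 'M[R]_c.+1.

(** Right multiplication by the shift moves every row one step to the left,
    filling in with 0. *)
Definition shift_mx : E := \matrix_(i, j) (i == j.+1 :> nat)%:R.

Lemma shift_mxX k i j : (shift_mx ^+ k) i j = (i == j + k :> nat)%N%:R.
Proof.
elim: k i j => [|k IH] i j; first by rewrite expr0 mxE addn0.
rewrite exprSr mxE; under eq_bigr => l _ do rewrite IH mxE.
case: (ltnP j.+1 c.+1) => [jc|cj].
  rewrite (bigD1 (Ordinal jc)) //= eqxx mulr1 big1 ?addr0 ?addSnnS // => l lj.
  by case: (nat_of_ord l =P j.+1) => [lE|_]; rewrite ?mulr0 //; case/eqP: lj; apply: val_inj.
rewrite big1 => [|l _]; last first.
  by case: (nat_of_ord l =P j.+1) => [lE|_]; rewrite ?mulr0 //; have := ltn_ord l; lia.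
by rewrite (_ : (_ == _) = false) //; have := ltn_ord i; lia.
Qed.

Lemma shift_mx_nilpotent : shift_mx ^+ c.+1 = 0.
Proof.
apply/matrixP => i j; rewrite shift_mxX mxE (_ : (_ == _) = false) //.
by have := ltn_ord i; lia.
Qed.

Lemma mul_shift_mx (v : E) i (j : 'I_c.+1) (jc : (j.+1 < c.+1)%N) :
  (v * shift_mx) i j = v i (Ordinal jc).
Proof.
rewrite mxE (bigD1 (Ordinal jc)) //= mxE eqxx mulr1 big1 ?addr0 // => l lj.
rewrite mxE.
by case: (nat_of_ord l =P j.+1) => [lE|_]; rewrite ?mulr0 //; case/eqP: lj; apply: val_inj.
Qed.

Lemma mul_shift_mx_last (v : E) i (j : 'I_c.+1) : (c <= j)%N -> (v * shift_mx) i j = 0.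
Proof.
move=> cj; rewrite mxE big1 // => l _; rewrite mxE.
by case: (nat_of_ord l =P j.+1) => [lE|_]; rewrite ?mulr0 //; have := ltn_ord l; lia.
Qed.

Lemma unit_add1_shift : (1 + shift_mx) \is a GRing.unit.
Proof.
apply: (@mulmx1_unit _ _ _ (\sum_(i < c.+1) (- shift_mx) ^+ i) _).1.
have := subrX1 (- shift_mx) c.+1; rewrite exprNn shift_mx_nilpotent mulr0 sub0r.
by rewrite -opprD mulNr [shift_mx + 1]addrC => /oppr_inj/esym.
Qed.

Lemma mulrz_mxE (v : E) z i j : (v *~ z) i j = v i j *~ z.
Proof. by case: z => k; rewrite ?NegzE ?mulrNz ?mxE -!pmulrn mulmxnE. Qed.

End ShiftMatrix.

Section ShiftOperator.
Local Open Scope ring_scope.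

Lemma dvdzD (k x y : int) : (k %| x)%Z -> (k %| y)%Z -> (k %| x + y)%Z.
Proof. exact: rpredD. Qed.

Lemma dvdzB (k x y : int) : (k %| x)%Z -> (k %| y)%Z -> (k %| x - y)%Z.
Proof. exact: rpredB. Qed.

Lemma Zp_intr_eq0 N (z : int) : (1 < N)%N -> (z%:~R == 0 :> 'Z_N) = (N %| z)%Z.
Proof.
move=> N1; have H k : (k%:R == 0 :> 'Z_N) = (N %| k)%N.
  by rewrite Zp_nat -val_eqE /= Zp_cast.
case: z => k; first by rewrite -pmulrn H.
by rewrite NegzE mulrNz oppr_eq0 -pmulrn H.
Qed.

(** The kernel of the exponent sum in a, made abelian and cut at class c.+2, is
    the module generated by b over Z[t, 1/t] with relations m t b = n b and
    (t - 1) ^ c.+2 b = 0. It is represented on rows of length c.+2 over Z / N,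
    where t acts as 1 plus the shift. A scalar action of t would not do:
    modulo N = d k ^ c.+2 it makes t - 1 a multiple of k, whose c.+2-th power
    need not vanish; modulo k ^ c.+2 that power vanishes, but the factor d
    common to m and n can no longer be cancelled. *)
Variables (m n d m' n' mu : int) (c : nat).
Let k := n' - m'.
Hypotheses (mE : m = d * m') (nE : n = d * n') (d_gt0 : 0 < d) (k_gt1 : (1 < `|k|)%N).
Hypothesis muP : (k ^+ c.+2 %| m' * mu - 1)%Z.

Let N := `|(d * k ^+ c.+2)%R|%N.
Let E := 'M['Z_N]_c.+2.
Let T : E := 1 + shift_mx _ _.
Let unitT : T \is a GRing.unit := unit_add1_shift _ _.

(** mu is an inverse of m' modulo k ^ c.+2, so k mu stands for n'/m' - 1. Only
    the first row is ever read; it repeats so that the vectors live in a ring. *)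
Definition BS_vector : E := \matrix_(i, j) ((k * mu) ^+ j)%:~R.
Local Notation w := BS_vector.

Lemma modulus_gt1 : (1 < N)%N.
Proof.
have k0 : (0 < `|k| ^ c.+2)%N by rewrite expn_gt0; lia.
have : (1 < `|k| ^ c.+2)%N by rewrite -(exp1n c.+2) ltn_exp2r.
rewrite /N abszM abszX; have : (0 < `|d|)%N by lia.
by nia.
Qed.

Lemma modulus_dvd z : (z%:~R == 0 :> 'Z_N) = (d * k ^+ c.+2 %| z)%Z.
Proof. by rewrite (Zp_intr_eq0 _ modulus_gt1) !dvdzE absz_nat. Qed.

(** The rows are geometric progressions of ratio k mu, so the relation holds
    column by column; in the last column, where the progression is cut off, it
    holds because d k (k mu) ^ c.+1 is a multiple of the modulus. *)
Lemma BS_vector_relation : (w *~ m) * T = w *~ n.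
Proof.
suff H i j : w i j *~ (n - m) = (w * shift_mx _ _) i j *~ m.
  apply/matrixP => i j; rewrite mulrDr mulr1 mulrzAl mxE !mulrz_mxE -H.
  by rewrite -mulrzDr addrC subrK.
apply/eqP; rewrite -subr_eq0.
have [jc|cj] := ltnP j.+1 c.+2.
  rewrite mul_shift_mx !mxE -!mulrzA -intrB modulus_dvd mE nE.
  rewrite (_ : _ - _ = d * - ((k * mu) ^+ j * k) * (m' * mu - 1)).
    exact/dvdz_mul/muP/dvdz_mulr.
  by rewrite exprS /k; ring.
rewrite mul_shift_mx_last // mul0rz subr0 mxE -mulrzA modulus_dvd mE nE.
have -> : (j : nat) = c.+1 by have := ltn_ord j; lia.
rewrite (_ : _ * _ = d * k ^+ c.+2 * mu ^+ c.+1); first exact: dvdz_mulr.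
by rewrite exprMn [in RHS]exprS /k; ring.
Qed.

Definition coord (j : 'I_c.+2) (v : E) : int := (v ord0 j : nat)%:Z.
Let j1 : 'I_c.+2 := lift ord0 ord0.

Lemma coordE j v : (coord j v)%:~R = v ord0 j.
Proof. by rewrite /coord -pmulrn natr_Zp. Qed.

Lemma dvd_k_modulus z : (d * k ^+ c.+2 %| z)%Z -> (k %| z)%Z.
Proof. by apply: dvdz_trans; rewrite exprS mulrCA dvdz_mulr. Qed.

Lemma dvd_k_cancel z : (k %| m' * z)%Z -> (k %| z)%Z.
Proof.
move=> kz; have -> : z = mu * (m' * z) - (m' * mu - 1) * z by ring.
apply: dvdzB; first exact: dvdz_mull.
by apply/dvdz_mulr/(dvdz_trans _ muP); rewrite exprS dvdz_mulr.
Qed.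

Lemma mulT_entry v : (v * T) ord0 ord0 = v ord0 ord0 + v ord0 j1.
Proof.
rewrite mulrDr mulr1 mxE (@mul_shift_mx _ _ v ord0 ord0 isT).
by congr (_ + v _ _); apply: val_inj.
Qed.

(** Here the common factor d of m and n is cancelled against that of the
    modulus. *)
Lemma relation_coord v :
  (v *~ m) * T = v *~ n -> (k ^+ c.+2 %| m' * coord j1 v - k * coord ord0 v)%Z.
Proof.
move=> /matrixP/(_ ord0 ord0); rewrite mulT_entry !mulrz_mxE => /eqP.
rewrite -!coordE -!mulrzA -intrD -subr_eq0 -intrB modulus_dvd => Dv.
have d0 : d != 0 by lia.
rewrite -(dvdz_mul2l d0); apply: etrans Dv; congr (_ %| _)%Z.
by rewrite mE nE /k; ring.
Qed.

Lemma inverse_relation_coord v :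
  v *~ m = (v *~ n) * T ->
  (k ^+ c.+2 %| m' * coord ord0 v - n' * (coord ord0 v + coord j1 v))%Z.
Proof.
move=> /matrixP/(_ ord0 ord0); rewrite mulT_entry !mulrz_mxE => /eqP.
rewrite -!coordE -!mulrzA -intrD -subr_eq0 -intrB modulus_dvd => Dv.
have d0 : d != 0 by lia.
rewrite -(dvdz_mul2l d0); apply: etrans Dv; congr (_ %| _)%Z.
by rewrite mE nE; ring.
Qed.

Lemma coord0D u v : (k %| coord ord0 (u + v) - coord ord0 u - coord ord0 v)%Z.
Proof.
by apply: dvd_k_modulus; rewrite -modulus_dvd !intrB !coordE mxE addrAC addrK subrr.
Qed.

Lemma coord0T v :
  (v *~ m) * T = v *~ n -> (k %| coord ord0 (v * T) - coord ord0 v)%Z.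
Proof.
move=> vT; have kv1 : (k %| coord j1 v)%Z.
  apply: dvd_k_cancel.
  rewrite (_ : m' * _ = (m' * coord j1 v - k * coord ord0 v) + k * coord ord0 v); last by ring.
  apply: dvdzD; last exact: dvdz_mulr.
  by apply: dvdz_trans (relation_coord vT); rewrite exprS dvdz_mulr.
rewrite (_ : _ - _ = (coord ord0 (v * T) - coord ord0 v - coord j1 v) + coord j1 v); last by ring.
apply: dvdzD => //; apply: dvd_k_modulus.
by rewrite -modulus_dvd !intrB !coordE mulT_entry addrAC addrK subrr.
Qed.

Lemma relation_exprz v z :
  (v *~ m) * T = v *~ n -> ((v * T ^ z) *~ m) * T = (v * T ^ z) *~ n.
Proof.
move=> vT; rewrite -!mulrzAl -vT -!mulrA; congr (_ * _).
exact/esym/commr_exprz/commr_refl.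
Qed.

Lemma coord0Tz v z :
  (v *~ m) * T = v *~ n -> (k %| coord ord0 (v * T ^ z) - coord ord0 v)%Z.
Proof.
move=> vT; elim/int_rec: z => [|z IH|z IH]; first by rewrite mulr1 subrr.
- have /coord0T := relation_exprz z vT.
  rewrite -mulrA -{2}[T]expr1z -exprzDr // -PoszD addn1 => H.
  by have := dvdzD H IH; rewrite addrA subrK.
- have /coord0T := relation_exprz (- z.+1%:Z) vT.
  rewrite -mulrA -{2}[T]expr1z -exprzDr // (_ : - _ + 1 = - z%:Z); last by lia.
  by move=> H; have := dvdzB IH H; rewrite opprB addrC addrA subrK.
Qed.

Let H : groupType := affine_group unitT.
Let Q : groupType := nilpotent_quotient (BS m n) c.+2.
Let a : Q := nilBSa m n c.+2.
Let b : Q := nilBSb m n c.+2.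

Lemma BS_representation : exists rho : {multiplicative Q -> H},
  rho a = (1, 0) /\ rho b = (0, w).
Proof.
apply: nilBS_lift.
  rewrite !affine_expgz affine_invE !affine_mulE /=.
  by rewrite oppr0 !mul0r add0r !addr0 addNr expr1z BS_vector_relation.
move=> x /affine_lower_central[x1 [u xu]]; rewrite [x]surjective_pairing x1 xu.
by rewrite /T addrAC subrr add0r shift_mx_nilpotent mulr0.
Qed.

Lemma k_neq0 : k != 0.
Proof. by lia. Qed.

Lemma m_neq_n : m != n.
Proof. by rewrite mE nE -subr_eq0 -mulrBr mulf_neq0 //; have := k_neq0; rewrite /k; lia. Qed.

Section Automorphism.
Variables (rho : {multiplicative Q -> H}) (phi : {multiplicative Q -> Q}).
Hypotheses (rhoa : rho a = (1, 0)) (rhob : rho b = (0, w)) (phi_bij : bijective phi).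

Let eps (x : Q) : int := (rho x).1.
Let vec (x : Q) : E := (rho x).2.

Lemma epsM x y : eps (x * y)%g = eps x + eps y.
Proof. by rewrite /eps gmulfM. Qed.

Lemma epsV x : eps (x^-1)%g = - eps x.
Proof. by rewrite /eps morphVg. Qed.

Lemma eps_expgz x i : eps (expgz x i) = i * eps x.
Proof. by rewrite /eps morph_expgz affine_expgz_fst. Qed.

Lemma vecM x y : vec (x * y)%g = vec x * T ^ eps y + vec y.
Proof. by rewrite /vec gmulfM. Qed.

Lemma eps_a : eps a = 1.
Proof. by rewrite /eps rhoa. Qed.

Lemma eps_b : eps b = 0.
Proof. by rewrite /eps rhob. Qed.

(** Z is torsion free and m, n are different, so every morphism from BS(m, n) to
    Z kills b. *)
Lemma eps_phi_b : eps (phi b) = 0.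
Proof.
have := congr1 (eps \o phi) (nilBS_relation m n c.+2).
rewrite /= !gmulfM morphVg !epsM epsV !morph_expgz !eps_expgz -/b addrAC addNr add0r.
move=> /eqP; rewrite -subr_eq0 -mulrBl mulf_eq0 subr_eq0 (negPf m_neq_n) /=.
by move/eqP.
Qed.

Lemma eps_phi x : eps (phi x) = eps (phi a) * eps x.
Proof.
apply: (nilBS_ind (H := [set x | eps (phi x) = eps (phi a) * eps x])%classic) x => /=.
- split=> [|x y /= xE yE]; first by rewrite /= morph1g /eps morph1g mulr0.
  by rewrite gmulfM morphVg !epsM !epsV xE yE mulrBr.
- by rewrite eps_a mulr1.
- by rewrite eps_phi_b eps_b mulr0.
Qed.

Lemma eps_phi_a : eps (phi a) = 1 \/ eps (phi a) = -1.
Proof.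
have [psi _ psiK] := phi_bij; have := eps_phi (psi a).
rewrite psiK eps_a => /(congr1 absz)/esym/eqP.
by rewrite abszM muln_eq1 => /andP[/eqP e1 _]; lia.
Qed.

(** m t = n holds on the generator of the module, hence everywhere. *)
Lemma vec_relation x : (vec x *~ m) * T = vec x *~ n.
Proof.
apply: (nilBS_ind (H := [set x | (vec x *~ m) * T = vec x *~ n])%classic) x => /=.
- split=> [|x y /= xE yE]; first by rewrite /= /vec morph1g /= !mul0rz mul0r.
  rewrite vecM !mulrzDl mulrDl; congr (_ + _); first exact: relation_exprz.
  rewrite /vec morphVg affine_invE /= !mulNr !mulNrz !mulNr; congr (- _).
  exact: relation_exprz.
- by rewrite /vec rhoa /= !mul0rz mul0r.
- by rewrite /vec rhob BS_vector_relation.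
Qed.

(** Modulo k the action of t is trivial, so the first coordinate of the vector
    part is additive there: it is the exponent sum in b. *)
Let bexp x : int := coord ord0 (vec x).

Lemma bexpM x y : (k %| bexp (x * y)%g - bexp x - bexp y)%Z.
Proof.
have := dvdzD (coord0D (vec x * T ^ eps y) (vec y)) (coord0Tz (eps y) (vec_relation x)).
by rewrite -vecM; congr (_ %| _)%Z; rewrite /bexp; ring.
Qed.

Lemma bexp1 : bexp 1%g = 0.
Proof. by rewrite /bexp /vec morph1g /coord mxE. Qed.

Lemma bexp_a : bexp a = 0.
Proof. by rewrite /bexp /vec rhoa /coord mxE. Qed.

Lemma bexp_b : (k %| bexp b - 1)%Z.
Proof.
apply: dvd_k_modulus; rewrite -modulus_dvd intrB coordE /vec rhob /= mxE.
by rewrite subrr.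
Qed.

Lemma bexpV x : (k %| bexp (x^-1)%g + bexp x)%Z.
Proof. by have := bexpM (x^-1)%g x; rewrite mulVg bexp1 sub0r -opprD rpredN. Qed.

Lemma bexp_phi x : (k %| bexp (phi x) - eps x * bexp (phi a) - bexp x * bexp (phi b))%Z.
Proof.
apply: (nilBS_ind (H := [set x | (k %| bexp (phi x) - eps x * bexp (phi a) - bexp x * bexp (phi b))%Z])%classic) x => /=.
- split=> [|x y /= xP yP].
    by rewrite /= morph1g bexp1 /eps morph1g !mul0r subrr.
  rewrite gmulfM morphVg epsM epsV.
  have H1 := dvdzD (bexpM (phi x) (phi y)^-1) (bexpV (phi y)).
  have H2 := dvdzD (bexpM x y^-1) (bexpV y).
  have := dvdzB (dvdzD H1 (dvdzB xP yP)) (dvdz_mulr (bexp (phi b)) H2).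
  by congr (_ %| _)%Z; ring.
- by rewrite eps_a mul1r bexp_a subrr mul0r subrr.
- rewrite eps_b mul0r subr0 -[X in X - _]mul1r -mulrBl dvdz_mulr //.
  by rewrite -opprB rpredN bexp_b.
Qed.

(** If the exponent sum in a is negated, phi intertwines t with its inverse. The
    image g of b then satisfies m g = n t g besides m t g = n g. Eliminating
    t g between the first coordinates gives n'^2 = m'^2 modulo k ^ c.+2, up to
    the first coordinate of g, which surjectivity of phi makes a unit modulo
    k. *)
Lemma inversion_dvd : eps (phi a) = -1 -> (k ^+ c.+2 %| n' ^+ 2 - m' ^+ 2)%Z.
Proof.
move=> eps_phi_a_eq; set g := vec (phi b).
have gE : rho (phi b) = (0, g) by rewrite -eps_phi_b -surjective_pairing.
have gT : (g *~ m) * T = g *~ n := vec_relation (phi b).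
have gTV : g *~ m = (g *~ n) * T.
  have rel : (expgz b m * a = a * expgz b n)%g.
    by rewrite -(nilBS_relation m n c.+2) -!mulgA mulVKg.
  have := congr1 (rho \o phi) rel.
  rewrite /= !gmulfM !morph_expgz gE !affine_expgz !affine_mulE => -[_ /=].
  rewrite -/(eps _) -/(vec _) eps_phi_a_eq mulr1 addrC => /addrI <-.
  by rewrite -mulrA -{2}[T]expr1z -exprzDr // addNr mulr1.
(* The combination - n' D1 - m' D2 eliminates the second coordinate of g. *)
have D1 := relation_coord gT; have D2 := inverse_relation_coord gTV.
have Dg : (k ^+ c.+2 %| (n' ^+ 2 - m' ^+ 2) * bexp (phi b))%Z.
  have := dvdzB (dvdz_mulr (- n') D1) (dvdz_mulr m' D2).
  by congr (_ %| _)%Z; rewrite /bexp -/g /k; ring.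
have [psi _ psiK] := phi_bij.
have eps_psi_b : eps (psi b) = 0.
  have := eps_phi (psi b); rewrite psiK eps_b eps_phi_a_eq mulN1r => /eqP.
  by rewrite eq_sym oppr_eq0 => /eqP.
(* Compare both values of the exponent sum in b at phi (psi b) = b. *)
have unit_bexp : (k %| 1 - bexp (psi b) * bexp (phi b))%Z.
  have := dvdzB (bexp_phi (psi b)) bexp_b; rewrite psiK eps_psi_b.
  by congr (_ %| _)%Z; ring.
have /dvdzP[q qE] := unit_bexp.
move: Dg; rewrite Gauss_dvdzl //; apply/coprimezXl/coprimezP.
by exists (q, bexp (psi b)); rewrite /= -qE; ring.
Qed.

End Automorphism.

(** The remaining automorphisms preserve the exponent sum in a, which is then
    constant on twisted classes and takes all integer values. *)
Lemma nilBS_Rinfty : ~~ (k ^+ c.+2 %| n' ^+ 2 - m' ^+ 2)%Z -> has_Rinfty Q.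
Proof.
move=> ndvd phi phi_bij; have [rho [rhoa rhob]] := BS_representation.
have [phi_a|phi_aN] := eps_phi_a rhoa rhob phi_bij; last first.
  by have := inversion_dvd rhoa rhob phi_bij phi_aN; rewrite (negPf ndvd).
apply: (infinite_Reidemeister_invariant (e := fun x => (rho x).1)) => [z y|i].
  rewrite !epsM epsV (eps_phi phi rhoa rhob) phi_a mul1r.
  by rewrite addrAC subrr add0r.
by exists (expgz a i); rewrite eps_expgz (eps_a rhoa) mulr1.
Qed.

End ShiftOperator.

(** * Degrees of Baumslag-Solitar groups *)

Section RinftyDegree.
Local Open Scope classical_set_scope.

Lemma Rinfty_degree_None (G : groupType) :
  (forall c, ~ Rinfty_at G c) -> Rinfty_nilpotency_degree G = None.
Proof.
move=> RG; rewrite /Rinfty_nilpotency_degree; case: pselect => // ex.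
by exfalso; case: ex => c /RG.
Qed.

Lemma Rinfty_degree_Some (G : groupType) c : Rinfty_at G c ->
  exists c', [/\ Rinfty_nilpotency_degree G = Some c', Rinfty_at G c' & (c' <= c)%N].
Proof.
move=> Rc; rewrite /Rinfty_nilpotency_degree; case: pselect => [ex|nex]; last by case: nex; exists c.
case: ex_minnP => c' Rc' minc'; exists c'; split=> //; first exact/asboolP.
exact/minc'/asboolP.
Qed.

End RinftyDegree.

Section BSRinftyDegree.
Variables m n : int.
Local Open Scope group_scope.
Local Open Scope classical_set_scope.

(** In the abelianization conjugation by a and by its inverse agree. *)
Lemma nilBS1_not_Rinfty : m <> n -> ~ Rinfty_at (BS m n) 1.
Proof.
move=> mn [_]; apply: not_Rinfty_neq mn _.
have comm : commute (nilBSb m n 1) (nilBSa m n 1).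
  apply/commgP/eqP; apply: nilpotent_quotient_lower_central.
  exact: (@lower_central_commg _ 0).
have commz := commute_expgz m (commute_sym comm).
by rewrite commz mulgK -(nilBS_relation m n 1) -mulgA -commz mulKg.
Qed.

Lemma BS_opp_not_Rinfty c : m <> 0%R -> n = (- m)%R -> ~ Rinfty_at (BS m n) c.
Proof.
move=> m0 nE [_]; apply: not_Rinfty_neq; first by lia.
have bm : expgz (nilBSb m n c) m = (expgz (nilBSb m n c) n)^-1.
  by rewrite -expgzN nE opprK.
by rewrite {1}bm -{1}(nilBS_relation m n c) !invgM invgK !mulgA mulgV mul1g mulgK bm invgK.
Qed.

(** b ^ d = [b ^ m, a] and b ^ m is a power of b ^ d, so b ^ d lies in every term
    of the lower central series. Modulo it the defining relation is void. *)
Lemma BS_gcd_not_Rinfty c d :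
  d <> 0%R -> (n - m)%R = d -> (d %| m)%Z -> ~ Rinfty_at (BS m n) c.
Proof.
move=> d0 nmd /dvdzP[m' mE] [_]; apply: not_Rinfty_neq; first by lia.
set a := nilBSa m n c; set b := nilBSb m n c.
have bdE : expgz b d = [~ expgz b m, a].
  by rewrite -nmd addrC expgzD expgzN -(nilBS_relation m n c) -mulgA -commgEl.
have bmE : expgz b m = expgz (expgz b d) m'.
  by rewrite -expgzM mulrC -mE.
have bd_central i : lower_central i.+1 (expgz b d).
  elim: i => [//|i IH]; rewrite bdE bmE.
  apply: lower_central_commgr.
  exact: (subgroup_expgz _ (@subgroup_lower_central _ i.+1)).
have bd1 : expgz b d = 1 by exact: nilpotent_quotient_lower_central.
have bm1 : expgz b m = 1 by rewrite bmE bd1 exp1gz.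
have bn1 : expgz b n = 1 by rewrite -bd1 -nmd addrC expgzD expgzN bm1 invg1 mul1g.
by rewrite bm1 bn1 mulg1 mulgV.
Qed.

End BSRinftyDegree.

Section BSRinfty.
Local Open Scope ring_scope.

Variables m n : int.
Let d := gcdz m n.
Let m' := (m %/ d)%Z.
Let n' := (n %/ d)%Z.
Hypothesis m_gt0 : 0 < m.

Lemma BS_gcd_gt0 : 0 < d.
Proof. by rewrite /d /gcdz ltz_nat gcdn_gt0 absz_gt0 gt_eqF. Qed.

Lemma m_div_gcd : m = d * m'.
Proof. by rewrite mulrC divzK // dvdz_gcdl. Qed.

Lemma n_div_gcd : n = d * n'.
Proof. by rewrite mulrC divzK // dvdz_gcdr. Qed.

Lemma coprime_div_gcd : coprimez m' n'.
Proof.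
have d0 := BS_gcd_gt0; have := erefl d; rewrite {1}/d {1}m_div_gcd {1}n_div_gcd.
rewrite -mulz_gcdr gtz0_abs //.
have d_inj : injective ( *%R d) by apply: mulfI; rewrite gt_eqF.
by rewrite -[X in _ = X -> _]mulr1 => /d_inj; rewrite /coprimez => ->.
Qed.

Lemma coprime_diff_gcd : coprimez m' (n' - m').
Proof.
have /coprimezP[[u v] /= uv1] := coprime_div_gcd.
by apply/coprimezP; exists (u + v, v) => /=; rewrite -uv1; ring.
Qed.

Lemma BS_Rinfty c : (1 < `|n' - m'|)%N ->
  ~~ ((n' - m') ^+ c.+2 %| n' ^+ 2 - m' ^+ 2)%Z -> Rinfty_at (BS m n) c.+2.
Proof.
move=> k_gt1 ndvd; split=> //.
have /(coprimezXr c.+2)/coprimezP[[u v] /= uv1] := coprime_diff_gcd.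
apply: (nilBS_Rinfty (mu := u) m_div_gcd n_div_gcd BS_gcd_gt0 k_gt1) ndvd.
by rewrite mulrC -uv1 opprD addrA subrr sub0r rpredN dvdz_mull.
Qed.

(** n'^2 - m'^2 = k (n' + m'), so k ^ 2 divides it only if k divides
    n' + m' = k + 2 m'; as k is prime to m', this means that k divides 2. *)
Lemma BS_Rinfty2 : (2 < `|n' - m'|)%N -> Rinfty_at (BS m n) 2.
Proof.
move=> k_gt2; apply: BS_Rinfty; first by lia.
have k0 : n' - m' != 0 by lia.
rewrite subr_sqr exprSr expr1 dvdz_mul2l //.
rewrite (_ : n' + m' = (n' - m') + m' * 2); last by ring.
apply/negP => /(fun H => dvdzB H (dvdzz (n' - m'))).
rewrite [n' - m' + _]addrC addrK Gauss_dvdzr; last by rewrite coprimez_sym coprime_diff_gcd.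
by rewrite dvdzE => /dvdn_leq; lia.
Qed.

End BSRinfty.

Local Open Scope ring_scope.

Theorem theorem5p4 (m n d : int) (p : nat)
    (hm : 0 < m) (hmn : m <= `|n|)
    (hd : d = gcdz m n)
    (hp : (2 ^+ p %| 2 * (m %/ d)%Z + 2)%Z)
    (hpmax : forall q : nat, (2 ^+ q %| 2 * (m %/ d)%Z + 2)%Z -> (q <= p)%N) :
  let r := Rinfty_nilpotency_degree (BS m n) in
  (n < 0 -> n <> - m -> r = Some 2%N) /\
  (n = - m -> r = None) /\
  (n = m -> r = None) /\
  (n - m = d -> r = None) /\
  (n - m = 2 * d -> exists2 c : nat, r = Some c & (2 <= c <= p + 2)%N) /\
  (n - m >= 3 * d -> r = Some 2%N).
Proof.
have d_gt0 : 0 < d by rewrite hd; exact: BS_gcd_gt0.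
set m' := (m %/ d)%Z in hp hpmax *; pose n' := (n %/ d)%Z.
have mE : m = d * m' by rewrite /m' hd; exact: m_div_gcd.
have nE : n = d * n' by rewrite /n' hd; exact: n_div_gcd.
have m'_gt0 : 0 < m' by rewrite mE pmulr_rgt0 in hm.
have nmE : n - m = d * (n' - m') by rewrite mE nE mulrBr.
have bounds c : m <> n -> Rinfty_at (BS m n) c ->
    exists c', [/\ Rinfty_nilpotency_degree (BS m n) = Some c', (1 < c')%N & (c' <= c)%N].
  move=> mn /Rinfty_degree_Some[c' [-> Rc' c'c]]; exists c'; split=> //.
  case: c' Rc' {c'c} => [|[|c']] //; first by case.
  by move/(nilBS1_not_Rinfty mn).
have degree2 : m <> n -> (2 < `|(n' - m')%R|)%N -> Rinfty_nilpotency_degree (BS m n) = Some 2%N.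
  move=> mn k3; have R2 : Rinfty_at (BS m n) 2 by apply: BS_Rinfty2; rewrite -?hd.
  have [c [-> c1 c2]] := bounds _ mn R2; congr Some; lia.
split=> [n_lt0 n_m|]; first by apply: degree2; nia.
split=> [n_m|]; first by apply: Rinfty_degree_None => c; apply: BS_opp_not_Rinfty => //; lia.
split=> [->|].
  by apply: Rinfty_degree_None => c [_]; apply: not_Rinfty_eq; lia.
split=> [nm_d|].
  apply: Rinfty_degree_None => c; apply: BS_gcd_not_Rinfty nm_d _; first by lia.
  by rewrite hd dvdz_gcdl.
split=> [nm_2d|nm_3d]; last first.
  by apply: degree2; nia.
have k2 : n' - m' = 2.
  by apply: (mulfI (lt0r_neq0 d_gt0)); rewrite -nmE nm_2d mulrC.
(* Here n'^2 - m'^2 = 2 (2 m' + 2) is divisible by 2 ^ p.+1 but not 2 ^ p.+2. *)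
have Rp : Rinfty_at (BS m n) p.+2.
  apply: BS_Rinfty => //; rewrite -hd -/m' -/n' k2 //.
  rewrite subr_sqr k2 exprS dvdz_mul2l //.
  have -> : n' + m' = 2 * m' + 2 by lia.
  by apply/negP => /hpmax; rewrite ltnn.
have [|c [-> c1 c2]] := bounds _ _ Rp; first by lia.
by exists c => //; rewrite c1 addn2.
Qed.
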